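(* Let an $s$-stage explicit Runge-Kutta method with coefficients $a_{ij}$, $b_i$ be a 2N-storage method with 2N-storage coefficients $A_i$, $B_i$ such that $A_i\neq0$ for $i=2,\dots,s$. Then the mapping from the $A$-form to the $a$-form is $$a_{ij}=\sum_{k=j+1}^{i}B_{k-1}\prod_{l=j+1}^{k-1}A_l\quad(1\le j<i\le s),\qquad b_i=\sum_{k=i+1}^{s+1}B_{k-1}\prod_{l=i+1}^{k-1}A_l\quad(1\le i\le s),$$ and the inverse mapping from the $a$-form to the $A$-form is given, for $i=2,\dots,s$, by $$A_i=\frac{a_{k,i-1}-a_{k-1,i-1}}{a_{ki}-a_{k-1,i}}\quad\text{for any }k\text{ such that } i<k\le s,$$ or by $$A_i=\frac{b_{i-1}-a_{s,i-1}}{b_i-a_{s,i}},$$ and $$B_i=a_{i+1,i}\quad(i=1,\dots,s-1),\qquad B_s=b_s.$$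
   Context: Empty sums equal $0$ and empty products equal $1$. An $s$-stage explicit Runge-Kutta method ($a$-form) has real coefficients $a_{ij}$ ($i,j=1,\dots,s$, $a_{ij}=0$ for $i\le j$), $b_i$ and nodes $c_i=\sum_{j=1}^{i-1}a_{ij}$ (so $c_1=0$). With step size $h$ it computes $y_i=y_0+h\sum_{j=1}^{i-1}a_{ij}k_j$, $k_i=f(t+c_ih,y_i)$, $i=1,\dots,s$, and $y_{s+1}=y_0+h\sum_{i=1}^s b_ik_i$. 2N-storage method ($A$-form): the method is a 2N-storage method with coefficients $A_1=0,A_2,\dots,A_s$ and $B_1,\dots,B_s$, all $B_i\ne0$, if its stages coincide (identically, as formal linear combinations of $y_0$ and $k_1,\dots,k_s$, treated as independent symbols) with those produced by $y_1=y_0$, $\Delta y_2=hk_1$, $\Delta y_i=A_{i-1}\Delta y_{i-1}+hk_{i-1}$ for $i=3,\dots,s+1$, and $y_i=y_{i-1}+B_{i-1}\Delta y_i$ for $i=2,\dots,s+1$. *)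

(* Defs.v *)
From mathcomp Require Import all_boot all_order all_algebra.
From mathcomp Require Import reals.

Set Implicit Arguments.
Unset Strict Implicit.
Unset Printing Implicit Defensive.

Import Order.TTheory GRing.Theory Num.Theory.
Local Open Scope ring_scope.

(** Coefficient arrays are total functions on [nat] with 1-based indices; only
    the entries with indices in [1..s] are ever constrained or read. *)

Definition explicit_rk (R : realType) (s : nat) (a : nat -> nat -> R) : Prop :=
  forall i j, (1 <= i <= s)%N -> (1 <= j <= s)%N -> (i <= j)%N -> a i j = 0.

(** A formal linear combination of the independent symbols y_0, k_1, ..., k_s
    is its row of s+1 coefficients: column 0 belongs to y_0 and column i to
    k_i.  [inord i] is the column i as long as i <= s. *)
Definition sym_y0 (R : realType) (s : nat) : 'rV[R]_s.+1 := delta_mx 0 ord0.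
Definition sym_k (R : realType) (s i : nat) : 'rV[R]_s.+1 :=
  delta_mx 0 (inord i).

(** y_i for 1 <= i <= s, and y_{s+1} for i = s+1. *)
Definition rk_stage (R : realType) (s : nat) (a : nat -> nat -> R)
    (b : nat -> R) (h : R) (i : nat) : 'rV[R]_s.+1 :=
  if (i <= s)%N
  then sym_y0 R s + h *: \sum_(1 <= j < i) a i j *: sym_k R s j
  else sym_y0 R s + h *: \sum_(1 <= j < s.+1) b j *: sym_k R s j.

(** Delta y_i, meaningful for i >= 2. *)
Fixpoint storage_dy (R : realType) (s : nat) (A : nat -> R) (h : R) (i : nat)
    : 'rV[R]_s.+1 :=
  match i with
  | (_.+2 as m).+1 => A m *: storage_dy s A h m + h *: sym_k R s m
  | 2 => h *: sym_k R s 1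
  | _ => 0
  end.

(** y_i, meaningful for i >= 1. *)
Fixpoint storage_y (R : realType) (s : nat) (A B : nat -> R) (h : R) (i : nat)
    : 'rV[R]_s.+1 :=
  match i with
  | (_.+1 as m).+1 => storage_y s A B h m + B m *: storage_dy s A h m.+1
  | _ => sym_y0 R s
  end.

Definition is_2N_storage (R : realType) (s : nat) (a : nat -> nat -> R)
    (b A B : nat -> R) : Prop :=
  [/\ A 1%N = 0,
      forall i, (1 <= i <= s)%N -> B i != 0
    & forall (h : R) i, (1 <= i <= s.+1)%N ->
        rk_stage s a b h i = storage_y s A B h i].

(* Main.v *)
Require Import Defs.
From mathcomp Require Import all_boot all_order all_algebra.
From mathcomp Require Import reals.

Set Implicit Arguments.
Unset Strict Implicit.
Unset Printing Implicit Defensive.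

Import Order.TTheory GRing.Theory Num.Theory.
Local Open Scope ring_scope.

(** Reading off, at step size 1, the coefficient of each symbol k_j in the
    2N-storage recursion gives the entries a_(i,j) and b_j (row s + 1) in closed
    form.  Consecutive rows k - 1 and k of that closed form differ by the single
    term B_(k-1) A_(j+1) ... A_(k-1), so that the quotient of the row differences
    in columns i - 1 and i telescopes to A_i. *)

Definition storage_coef (R : realType) (A B : nat -> R) (i j : nat) : R :=
  \sum_(j.+1 <= k < i.+1) B k.-1 * \prod_(j.+1 <= l < k) A l.

(** The bounds matter: [inord] sends every index above [s] to a default column. *)
Lemma inord_eq (s i j : nat) : (i <= s)%N -> (j <= s)%N ->
  (inord i == inord j :> 'I_s.+1) = (i == j).
Proof. by move=> hi hj; rewrite -val_eqE /= !inordK. Qed.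

Lemma sym_kE (R : realType) (s i j : nat) : (i <= s)%N -> (j <= s)%N ->
  sym_k R s i 0 (inord j) = (j == i)%:R.
Proof. by move=> hi hj; rewrite mxE eqxx /= inord_eq. Qed.

Lemma sym_y0E (R : realType) (s j : nat) : (1 <= j <= s)%N ->
  sym_y0 R s 0 (inord j) = 0.
Proof.
case/andP=> j0 js; rewrite mxE eqxx /= -val_eqE /= inordK //.
by rewrite eqn0Ngt j0.
Qed.

Lemma sum_sym_kE (R : realType) (s n j : nat) (u : nat -> R) :
  (n <= s.+1)%N -> (1 <= j <= s)%N ->
  (\sum_(1 <= k < n) u k *: sym_k R s k) 0 (inord j) =
  if (j < n)%N then u j else 0.
Proof.
move=> hn /andP[j0 js]; elim: n hn => [|[|n] IHn] hn.
- by rewrite big_geq // mxE.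
- by rewrite big_geq // mxE ltnS leqNgt j0.
rewrite big_nat_recr //= mxE (IHn (ltnW hn)) mxE sym_kE //.
rewrite (ltnS j n.+1) (leq_eqVlt j).
have [->|_] := eqVneq j n.+1; first by rewrite ltnn mulr1 add0r.
by rewrite mulr0 addr0.
Qed.

(** The symbol [k_j] enters at index [j + 1] with coefficient 1, and each passage from index [l] to
    [l + 1] multiplies it by [A_l]. *)
Lemma storage_dyE (R : realType) (s : nat) (A : nat -> R) (i j : nat) :
  (i <= s.+1)%N -> (1 <= j <= s)%N ->
  storage_dy s A 1 i 0 (inord j) =
  if (j < i)%N then \prod_(j.+1 <= l < i) A l else 0.
Proof.
move=> hi /andP[j0 js]; elim: i hi => [|[|[|i]] IHi] hi.
- by rewrite /= mxE.
- by rewrite /= mxE ltnS leqNgt j0.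
- rewrite /= scale1r sym_kE // ltnS leq_eqVlt ltnS [(j <= 0)%N]leqNgt j0 orbF.
  by case: eqP => // ->; rewrite big_geq.
have -> : storage_dy s A 1 i.+3 =
    A i.+2 *: storage_dy s A 1 i.+2 + 1 *: sym_k R s i.+2 by [].
rewrite scale1r mxE mxE (IHi (ltnW hi)) sym_kE //.
rewrite (ltnS j i.+2) (leq_eqVlt j).
(* The newest symbol is absent from the previous increment, so its coefficient is the empty
   product. *)
have [->|_] := eqVneq j i.+2; first by rewrite ltnn mulr0 add0r big_geq.
rewrite addr0 /=; case: ifP => [ji|_]; last by rewrite mulr0.
by rewrite (@big_nat_recr _ _ _ i.+2) //= mulrC.
Qed.

Lemma storage_coefS (R : realType) (A B : nat -> R) (i j : nat) :
  (j <= i)%N ->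
  storage_coef A B i.+1 j =
  storage_coef A B i j + B i * \prod_(j.+1 <= l < i.+1) A l.
Proof. by move=> ji; rewrite /storage_coef big_nat_recr. Qed.

Lemma storage_coef0 (R : realType) (A B : nat -> R) (i j : nat) :
  (i <= j)%N -> storage_coef A B i j = 0.
Proof. by move=> ij; rewrite /storage_coef big_geq. Qed.

(** Each update adds [B_i] times the next increment, whose coefficients are already known, so the
    sum over [k] builds up term by term. *)
Lemma storage_yE (R : realType) (s : nat) (A B : nat -> R) (i j : nat) :
  (i <= s.+1)%N -> (1 <= j <= s)%N ->
  storage_y s A B 1 i 0 (inord j) = storage_coef A B i j.
Proof.
move=> hi hj; have /andP[j0 js] := hj; elim: i hi => [|[|i] IHi] hi.
- by rewrite sym_y0E // storage_coef0.
- by rewrite sym_y0E // storage_coef0.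
have -> : storage_y s A B 1 i.+2 =
    storage_y s A B 1 i.+1 + B i.+1 *: storage_dy s A 1 i.+2 by [].
rewrite mxE mxE (IHi (ltnW hi)) storage_dyE // ltnS.
have [ji|ji] := leqP j i.+1; first by rewrite [RHS]storage_coefS.
by rewrite mulr0 addr0 !storage_coef0 // ltnW.
Qed.

Lemma rk_stage_coef (R : realType) (s : nat) (a : nat -> nat -> R)
    (b A B : nat -> R) :
  explicit_rk s a -> is_2N_storage s a b A B ->
  (forall i j, (1 <= i <= s)%N -> (1 <= j <= s)%N ->
     a i j = storage_coef A B i j) /\
  (forall j, (1 <= j <= s)%N -> b j = storage_coef A B s.+1 j).
Proof.
move=> hrk [_ _ hst]; split=> [i j hi hj|j hj].
  have /andP[i0 le_is] := hi.
  (* On and above the diagonal both sides vanish, the right one as an empty sum. Covering these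
     entries makes [a k i] available later even for [k = i]. *)
  have [ij|ji] := leqP i j; first by rewrite hrk // storage_coef0.
  rewrite -(storage_yE A B (leqW le_is) hj) -hst ?i0 ?leqW // /rk_stage le_is.
  by rewrite scale1r mxE sym_y0E // add0r sum_sym_kE ?leqW // ji.
have /andP[_ js] := hj.
rewrite -(storage_yE A B (leqnn _) hj) -hst ?leqnn // /rk_stage ltnn.
by rewrite scale1r mxE sym_y0E // add0r sum_sym_kE // ltnS js.
Qed.

(** Allowing [k = s] lets row [s + 1] stand for the weights [b], so both formulas for [A_i] are
    instances. *)
Lemma storage_coef_quotient (R : realType) (s : nat) (A B : nat -> R)
    (i k : nat) :
  (forall l, (2 <= l <= s)%N -> A l != 0) -> B k != 0 ->
  (2 <= i)%N -> (i <= k <= s)%N ->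
  storage_coef A B k.+1 i - storage_coef A B k i != 0 /\
  A i = (storage_coef A B k.+1 i.-1 - storage_coef A B k i.-1) /
        (storage_coef A B k.+1 i - storage_coef A B k i).
Proof.
move=> hA hB hi /andP[ik ks].
have i0 : (0 < i)%N := ltnW hi.
have nz : storage_coef A B k.+1 i - storage_coef A B k i != 0.
  (* The difference is [B_k] times the [A_l] with [i < l <= k], all of them nonzero. *)
  rewrite storage_coefS // addrC addKr mulf_neq0 // prodf_seq_neq0.
  apply/allP=> l; rewrite mem_index_iota /= => /andP[il lk].
  by rewrite hA // (leq_trans hi (ltnW il)) (leq_trans _ ks).
split=> //; apply: (canRL (mulfK nz)).
rewrite !storage_coefS ?(leq_trans (leq_pred i)) // ![storage_coef _ _ _ _ + _]addrC.
(* The product in column [i - 1] starts one index earlier; its extra first factor is [A_i]. *)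
by rewrite !addrK prednK // [in RHS]big_ltn ?ltnS // mulrCA.
Qed.

Lemma storage_coef_subdiag (R : realType) (A B : nat -> R) (i : nat) :
  storage_coef A B i.+1 i = B i.
Proof. by rewrite storage_coefS // storage_coef0 // big_geq // mulr1 add0r. Qed.

Theorem theorem3 (R : realType) (s : nat) (a : nat -> nat -> R)
    (b A B : nat -> R)
    (hs : (1 <= s)%N)
    (hrk : explicit_rk s a)
    (h2N : is_2N_storage s a b A B)
    (hA : forall i : nat, (2 <= i <= s)%N -> A i != 0) :
  [/\ (forall i j : nat, (1 <= j)%N -> (j < i)%N -> (i <= s)%N ->
        a i j = \sum_(j.+1 <= k < i.+1) B k.-1 * \prod_(j.+1 <= l < k) A l)
      /\ (forall i : nat, (1 <= i <= s)%N ->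
        b i = \sum_(i.+1 <= k < s.+2) B k.-1 * \prod_(i.+1 <= l < k) A l),
      forall i k : nat, (2 <= i <= s)%N -> (i < k <= s)%N ->
        a k i - a k.-1 i != 0
        /\ A i = (a k i.-1 - a k.-1 i.-1) / (a k i - a k.-1 i),
      forall i : nat, (2 <= i <= s)%N ->
        b i - a s i != 0
        /\ A i = (b i.-1 - a s i.-1) / (b i - a s i),
      forall i : nat, (1 <= i < s)%N -> B i = a i.+1 i
    & B s = b s].
Proof.
have [aE bE] := rk_stage_coef hrk h2N.
have [_ hB _] := h2N.
split.
- split=> [i j j0 ji le_is|i hi]; last exact: bE.
  by rewrite aE ?j0 ?(leq_trans (ltnW ji) le_is) ?(leq_trans j0 (ltnW ji)).
(* From here [k] denotes the lower of the two rows, so [i <= k < s]; for [k = i] the entry [a k i]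
   is a diagonal zero. *)
- move=> i [//|k] /andP[i2 le_is] /andP[]; rewrite ltnS /= => ik ks.
  have i1 : (1 <= i.-1)%N by rewrite -ltnS prednK // ltnW.
  have le_i1s : (i.-1 <= s)%N := leq_trans (leq_pred i) le_is.
  have i0 : (1 <= i)%N := ltnW i2.
  have k0 : (1 <= k)%N := leq_trans i0 ik.
  rewrite !aE ?i0 ?k0 ?i1 ?ks ?(ltnW ks) //.
  apply: storage_coef_quotient hA _ i2 _; first by rewrite hB // k0 ltnW.
  by rewrite ik ltnW.
- move=> i /andP[i2 le_is].
  have i1 : (1 <= i.-1)%N by rewrite -ltnS prednK // ltnW.
  have le_i1s : (i.-1 <= s)%N := leq_trans (leq_pred i) le_is.
  have i0 : (1 <= i)%N := ltnW i2.
  rewrite !aE ?bE ?hs ?i0 ?i1 ?leqnn //.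
  (* The same quotient with [k = s], between the last stage and the final update. *)
  apply: storage_coef_quotient hA _ i2 _; first by rewrite hB ?hs ?leqnn.
  by rewrite le_is leqnn.
- move=> i /andP[i0 lt_is].
  by rewrite aE ?i0 ?lt_is ?(ltnW lt_is) // storage_coef_subdiag.
- by rewrite bE ?hs ?leqnn // storage_coef_subdiag.
Qed.
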